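(* Let $\mathcal{A}=\{v_1,\dots,v_n\}\subset\mathbb{R}^m$, $A=[v_1\ \cdots\ v_n]\in\mathbb{R}^{m\times n}$, $p\in\mathbb{R}^m$, $R:=\max\{\|v_i-p\| : v_i\in\mathcal{A}\}$, $\varepsilon\in(0,1)$, and $\Phi(x):=\frac12\|Ax-p\|^2$. Let $\Delta_n=\{x\in\mathbb{R}^n : e^Tx=1,\ x\ge 0\}$, let $x^\star$ be a minimizer of $\Phi$ over $\Delta_n$, and set $L:=\|A\|^2$ (a Lipschitz constant of $\nabla\Phi$) and $D:=\sqrt2$ (the diameter of $\Delta_n$). Let $x_k\in\Delta_n$ be an iterate of the Spectral Projected Gradient (SPG) method applied to $\min_{x\in\Delta_n}\Phi(x)$, with spectral scaling parameter $$\lambda_k=\frac{s_{k-1}^Ts_{k-1}}{s_{k-1}^Tu_{k-1}},\qquad s_{k-1}:=x_k-x_{k-1},\quad u_{k-1}:=\nabla\Phi(x_k)-\nabla\Phi(x_{k-1}),$$ and let $\bar x_k:=P_{\Delta_n}(x_k-\lambda_k\nabla\Phi(x_k))$ and $d_k:=\bar x_k-x_k$. Then $1/\lambda_k\le L$ and $$\Phi(\bar x_k)-\Phi(x^\star)\le\tfrac32 LD\,\|\bar x_k-x_k\|.$$ Consequently, if $$\|d_k\|\le\frac{\|A\bar x_k-p\|}{3LD}\,\varepsilon R,$$ then $$\|A\bar x_k-p\|\le\|Ax^\star-p\|+\varepsilon R .$$ Hence, under this last condition on $\|d_k\|$: if $p\in\operatorname{conv}(\mathcal{A})$, then $\|A\bar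 x_k-p\|\le\varepsilon R$; and if $\|A\bar x_k-p\|>\varepsilon R$, then $\|Ax^\star-p\|>0$ and $p\notin\operatorname{conv}(\mathcal{A})$.
   Context: $\|\cdot\|$ is the Euclidean norm on vectors and the spectral (operator 2-) norm on matrices; $e\in\mathbb{R}^n$ is the all-ones vector; $P_{\Delta_n}$ is the Euclidean orthogonal projection onto $\Delta_n$; $\operatorname{conv}(\mathcal{A})$ is the convex hull of $\mathcal{A}$. The SPG method starts from some $x_0\in\Delta_n$ and iterates $x_{k+1}=x_k+\gamma_kd_k$, where $d_k=P_{\Delta_n}(x_k-\lambda_k\nabla\Phi(x_k))-x_k$, $\lambda_k$ is the spectral (Barzilai–Borwein) parameter given in the claim, and the step-size $\gamma_k\in(0,1]$ is obtained by starting from $\gamma=1$ and halving $\gamma$ until the nonmonotone condition $\Phi(x_k+\gamma d_k)\le\max\{\Phi(x_{k-j}) : 0\le j\le\min\{k,M-1\}\}+\eta\gamma\nabla\Phi(x_k)^Td_k$ holds, for fixed parameters $M\ge1$ (an integer) and $\eta\in(0,1)$. *)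

(* Defs.v *)
From HB Require Import structures.
From mathcomp Require Import all_boot all_order all_algebra.
From mathcomp Require Import all_classical all_reals all_analysis ring.

Set Implicit Arguments.
Unset Strict Implicit.
Unset Printing Implicit Defensive.

Import Order.TTheory GRing.Theory Num.Theory.
Import numFieldNormedType.Exports.

Local Open Scope classical_set_scope.
Local Open Scope ring_scope.

Definition dot (R : realType) (n : nat) (u v : 'cV[R]_n) : R :=
  (u^T *m v) 0 0.

(* The library norm `|u| on matrices is the max norm. *)
Definition enorm (R : realType) (n : nat) (u : 'cV[R]_n) : R :=
  Num.sqrt (dot u u).

Definition spectral_norm (R : realType) (m n : nat) (A : 'M[R]_(m, n)) : R :=
  sup [set enorm (A *m x) | x in [set x : 'cV[R]_n | enorm x <= 1]].

Definition gradient (R : realType) (n : nat) (f : 'cV[R]_n -> R)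
    (x : 'cV[R]_n) : 'cV[R]_n :=
  \col_i 'D_(delta_mx i 0) f x.

Definition is_minimizer (R : realType) (T : Type) (f : T -> R) (S : set T)
    (x : T) : Prop :=
  S x /\ forall y, S y -> f x <= f y.

(* The default value 0 is only taken when x has no nearest point in S;
   see eproj_simplexP for the simplex. *)
Definition eproj (R : realType) (n : nat) (S : set 'cV[R]_n) (x : 'cV[R]_n) :
    'cV[R]_n :=
  xget 0 [set y | is_minimizer (fun z => enorm (x - z)) S y].

Definition simplex (R : realType) (n : nat) : set 'cV[R]_n :=
  [set x | dot (const_mx 1) x = 1 /\ forall i, 0 <= x i 0].

Definition convex_hull (R : realType) (n : nat) (S : set 'cV[R]_n) :
    set 'cV[R]_n :=
  smallest (@convex_set R 'cV[R]_n) S.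

Definition mx_of_cols (R : realType) (m n : nat) (v : 'I_n -> 'cV[R]_m) :
    'M[R]_(m, n) :=
  \matrix_(i, j) v j i 0.

(* All terms are nonnegative, so the seed 0 is harmless when 0 < n. *)
Definition max_dist (R : realType) (m n : nat) (v : 'I_n -> 'cV[R]_m)
    (p : 'cV[R]_m) : R :=
  \big[Num.max/0]_(i < n) enorm (v i - p).

Definition half_sqdist (R : realType) (m n : nat) (A : 'M[R]_(m, n))
    (p : 'cV[R]_m) (x : 'cV[R]_n) : R :=
  enorm (A *m x - p) ^+ 2 / 2.

Section SPG.
Context {R : realType} {n : nat}.
Implicit Types (f : 'cV[R]_n -> R) (S : set 'cV[R]_n) (x : nat -> 'cV[R]_n).

Definition bb_s x j : 'cV[R]_n := x j - x j.-1.

Definition bb_u f x j : 'cV[R]_n := gradient f (x j) - gradient f (x j.-1).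

(* The Barzilai-Borwein quotient needs a previous iterate; the first value
   lambda0 is a free parameter of the method. *)
Definition spg_lambda f (lambda0 : R) x j : R :=
  if j == 0%N then lambda0
  else dot (bb_s x j) (bb_s x j) / dot (bb_s x j) (bb_u f x j).

Definition spg_trial f S (lambda0 : R) x j : 'cV[R]_n :=
  eproj S (x j - spg_lambda f lambda0 x j *: gradient f (x j)).

Definition spg_dir f S (lambda0 : R) x j : 'cV[R]_n :=
  spg_trial f S lambda0 x j - x j.

(* The seed f (x j) of the maximum is its term of index i = 0. *)
Definition nonmonotone_decrease f (M : nat) (eta : R) x j (d : 'cV[R]_n)
    (gamma : R) : Prop :=
  f (x j + gamma *: d) <=
    \big[Num.max/f (x j)]_(i < (minn j M.-1).+1) f (x (j - i)%N)
    + eta * gamma * dot (gradient f (x j)) d.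

Definition spg_step_size f (M : nat) (eta : R) x j (d : 'cV[R]_n)
    (gamma : R) : Prop :=
  exists t : nat,
    [/\ gamma = 2^-1 ^+ t,
        nonmonotone_decrease f M eta x j d gamma
      & forall t', (t' < t)%N ->
          ~ nonmonotone_decrease f M eta x j d (2^-1 ^+ t')].

(* x 0, ..., x k are the first iterates of a run (x is unconstrained beyond k,
   as the method may stop); the denominators of lambda_1, ..., lambda_(k-1)
   are required not to vanish since otherwise these are undefined. *)
Definition spg_iterates f S (M : nat) (eta lambda0 : R) x (k : nat) : Prop :=
  [/\ S (x 0%N),
      forall j, (0 < j < k)%N -> dot (bb_s x j) (bb_u f x j) != 0
    & forall j, (j < k)%N ->
        let d := spg_dir f S lambda0 x j in
        exists2 gamma, spg_step_size f M eta x j d gamma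
                     & x j.+1 = x j + gamma *: d].

End SPG.

Lemma dotE (R : realType) (n : nat) (u v : 'cV[R]_n) :
  dot u v = \sum_i u i 0 * v i 0.
Proof. by rewrite /dot mxE; apply: eq_bigr => i _; rewrite mxE. Qed.

Lemma eproj_simplexP (R : realType) (n : nat) (x : 'cV[R]_n) : (0 < n)%N ->
  is_minimizer (fun z => enorm (x - z)) (@simplex R n) (eproj (@simplex R n) x).
Proof.
move=> n_gt0; apply: (@xgetPex _ 0 [set y | is_minimizer _ _ y]).
pose K := [set r : 'rV[R]_n | simplex r^T].
have sumc (F : 'rV[R]_n -> 'I_n -> R) :
    (forall i, continuous (F ^~ i)) -> continuous (fun r => \sum_i F r i).
  move=> Fc r; elim: (index_enum _) => [|i s IHs].
    rewrite (_ : (fun _ => _) = cst 0); first exact: cst_continuous.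
    by apply/funext => q; rewrite big_nil.
  rewrite (_ : (fun _ => _) = (F ^~ i) \+ (fun q => \sum_(i <- s) F q i)).
    by apply: continuousD; [exact: Fc | exact: IHs].
  by apply/funext => q; rewrite big_cons.
have Kne : K !=set0.
  exists (delta_mx 0 (Ordinal n_gt0)); split; last first.
    by move=> i; rewrite !mxE ler0n.
  rewrite dotE (bigD1 (Ordinal n_gt0)) //= !mxE !eqxx mul1r big1 ?addr0//.
  by move=> i /negbTE ni; rewrite !mxE ni /= mulr0.
have Kcompact : compact K.
  have cK : compact [set r : 'rV[R]_n | forall i, `[(0 : R), 1]%classic (r ord0 i)].
    by apply: (@rV_compact _ _ (fun=> `[(0 : R), 1]%classic)) => _; exact: segment_compact.
  apply: subclosed_compact cK _; last first.
    move=> r [r1 r0] i /=; rewrite in_itv/=; have ri := r0 i.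
    rewrite mxE in ri; rewrite ri -r1 dotE (bigD1 i) //= !mxE mul1r lerDl.
    by apply: sumr_ge0 => j _; rewrite [const_mx _ _ _]mxE mul1r r0.
  have -> : K = (fun r : 'rV[R]_n => \sum_i r 0 i) @^-1` [set y | y = 1] `&`
      \bigcap_(i in setT) (fun r : 'rV[R]_n => r 0 i) @^-1` [set y | 0 <= y].
    apply/seteqP; split => r /=.
      move=> [r1 r0]; split => [|i _ /=]; last by have := r0 i; rewrite mxE.
      by rewrite -r1 dotE; apply: eq_bigr => i _; rewrite !mxE mul1r.
    move=> [r1 r0]; split => [|i]; last by rewrite mxE; exact: r0.
    by rewrite dotE -[RHS]r1; apply: eq_bigr => i _; rewrite !mxE mul1r.
  apply: closedI.
    move/continuous_closedP : (sumc (fun r i => r 0 i) (fun i => @coord_continuous _ _ _ _ _)).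
    by apply; exact: closed_eq.
  apply: closed_bigI => i _.
  move/continuous_closedP : (@coord_continuous R 1 n 0 i); apply.
  exact: closed_ge.
have [r rK rmin] : exists2 c, c \in K & forall t, t \in K ->
    enorm (x - c^T) <= enorm (x - t^T).
  apply: compact_EVT_min => //; apply: continuous_subspaceT => r.
  rewrite /enorm; apply: (@continuous_comp _ _ _
    (fun r : 'rV[R]_n => dot (x - r^T) (x - r^T))); last exact: sqrt_continuous.
  have -> : (fun r : 'rV[R]_n => dot (x - r^T) (x - r^T)) =
      fun r => \sum_i (x i 0 - r 0 i) * (x i 0 - r 0 i).
    by apply/funext => q; rewrite dotE; apply: eq_bigr => i _; rewrite !mxE.
  apply: sumc => i {}r.
  have cB : continuous (fun r : 'rV[R]_n => x i 0 - r 0 i).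
    by move=> q; apply: continuousB; [exact: cst_continuous | exact: coord_continuous].
  by apply: (@continuousM R 'rV[R]_n _ _ r (cB r) (cB r)).
exists r^T; split; first by move: rK; rewrite inE.
by move=> y yS; rewrite -[y]trmxK; apply: rmin; rewrite inE /K /= trmxK.
Qed.

Lemma gradient_half_sqdist (R : realType) (m n : nat) (A : 'M[R]_(m, n))
    (p : 'cV[R]_m) (x : 'cV[R]_n) :
  gradient (half_sqdist A p) x = A^T *m (A *m x - p).
Proof.
have hE y : half_sqdist A p y = dot (A *m y - p) (A *m y - p) / 2.
  by rewrite /half_sqdist /enorm sqr_sqrtr // dotE sumr_ge0 // => i _; rewrite -expr2 sqr_ge0.
have dotDl k (a b c : 'cV[R]_k) : dot (a + b) c = dot a c + dot b c.
  by rewrite /dot linearD mulmxDl mxE.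
have dotDr k (a b c : 'cV[R]_k) : dot c (a + b) = dot c a + dot c b.
  by rewrite /dot mulmxDr mxE.
have dotZl k t (a b : 'cV[R]_k) : dot (t *: a) b = t * dot a b.
  by rewrite /dot linearZ /= -scalemxAl mxE.
have dotC k (a b : 'cV[R]_k) : dot a b = dot b a.
  by rewrite !dotE; apply: eq_bigr => i _; rewrite mulrC.
apply/colP => i; rewrite mxE.
set e := delta_mx i 0; set b := A *m x - p; set a := A *m e.
have ->: (A^T *m b) i 0 = dot a b.
  by rewrite /dot /a trmx_mul -mulmxA trmx_delta -rowE [RHS]mxE.
apply: cvg_lim => //.
have lE : (fun h : R => h^-1 *: ((half_sqdist A p \o shift x) (h *: e) - half_sqdist A p x))
   =1 (fun h => h^-1 * h * (dot a b + h * (dot a a / 2))).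
  move=> h /=; rewrite !hE mulmxDr -scalemxAr -addrA -/b -/a.
  rewrite /GRing.scale /= -mulrA; congr (_ * _).
  move: (b) (a) => c g; rewrite dotDl !dotDr !dotZl.
  by rewrite (dotC _ g (h *: g)) dotZl (dotC _ c (h *: g)) dotZl; field.
rewrite (funext lE).
have c0 : (fun h : R => dot a b + h * (dot a a / 2)) @ 0^' --> dot a b.
  rewrite -[X in _ --> X]addr0 -[X in _ --> _ + X](mul0r (dot a a / 2)).
  apply: cvgD; first exact: cvg_cst.
  by apply: cvgMl; apply: cvg_within.
apply: cvg_trans c0; apply: near_eq_cvg.
near=> h; rewrite mulVf ?mul1r //.
near: h; exact: nbhs_dnbhs_neq.
Unshelve. all: by end_near.
Qed.

(* Main.v *)
(** Put [w = xbar - xstar] and [g = gradient Phi (x k)].  As [Phi] is quadratic,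
    [Phi xbar - Phi xstar = g.w + (A d).(A w) - |A w|^2 / 2 <= g.w + |A d|^2 / 2].
    The variational inequality of the projection bounds [g.w] by
    [|d| |w| / lambda <= L D |d|], because [1 / lambda = |A s|^2 / |s|^2 <= L],
    and [|A d|^2 <= L |d|^2 <= L D |d|].  The stopping criterion then says that the
    residuals [r], [rstar] at [xbar], [xstar] satisfy
    [(r - rstar) (r + rstar) <= r (eps rad)], whence [r - rstar <= eps rad].
    Finally, the convex hull of the points is the image of the simplex under [A],
    so [rstar = 0] whenever [p] lies in it. *)
Require Import Defs.
From HB Require Import structures.
From mathcomp Require Import all_boot all_order all_algebra.
From mathcomp Require Import all_classical all_reals all_analysis.
From mathcomp Require Import ring lra.

Set Implicit Arguments.
Unset Strict Implicit.
Unset Printing Implicit Defensive.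

Import Order.TTheory GRing.Theory Num.Theory.
Import numFieldNormedType.Exports.

Local Open Scope classical_set_scope.
Local Open Scope ring_scope.

(** * Euclidean inner product and norm *)

Section Dot.
Context {R : realType} {n : nat}.
Implicit Types u v w : 'cV[R]_n.

Lemma dotC u v : dot u v = dot v u.
Proof. by rewrite !dotE; apply: eq_bigr => i _; rewrite mulrC. Qed.

Lemma dotDl u v w : dot (u + v) w = dot u w + dot v w.
Proof. by rewrite /dot linearD mulmxDl mxE. Qed.

Lemma dotDr u v w : dot w (u + v) = dot w u + dot w v.
Proof. by rewrite !(dotC w) dotDl. Qed.

Lemma dotZl t u v : dot (t *: u) v = t * dot u v.
Proof. by rewrite /dot linearZ /= -scalemxAl mxE. Qed.

Lemma dotZr t u v : dot u (t *: v) = t * dot u v.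
Proof. by rewrite !(dotC u) dotZl. Qed.

Lemma dotNl u v : dot (- u) v = - dot u v.
Proof. by rewrite -scaleN1r dotZl mulN1r. Qed.

Lemma dotNr u v : dot u (- v) = - dot u v.
Proof. by rewrite !(dotC u) dotNl. Qed.

Definition dot_lin := (dotDl, dotDr, dotNl, dotNr, dotZl, dotZr).

Lemma dot_ge0 u : 0 <= dot u u.
Proof. by rewrite dotE sumr_ge0 // => i _; rewrite -expr2 sqr_ge0. Qed.

Lemma dot_eq0 u : (dot u u == 0) = (u == 0).
Proof.
apply/eqP/eqP => [|->]; last by rewrite dotE big1 // => i _; rewrite mxE mul0r.
rewrite dotE => /eqP; rewrite psumr_eq0; last first.
  by move=> i _; rewrite -expr2 sqr_ge0.
move=> /allP u0; apply/colP => i; rewrite mxE.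
by have := u0 i (mem_index_enum i); rewrite /= mulf_eq0 orbb => /eqP.
Qed.

Lemma enorm_ge0 u : 0 <= enorm u.
Proof. exact: sqrtr_ge0. Qed.

Lemma sqr_enorm u : enorm u ^+ 2 = dot u u.
Proof. by rewrite sqr_sqrtr // dot_ge0. Qed.

Lemma enormZ t u : enorm (t *: u) = `|t| * enorm u.
Proof.
by rewrite /enorm dotZl dotZr mulrA -expr2 sqrtrM ?sqr_ge0// sqrtr_sqr.
Qed.

Lemma enorm0 : enorm (0 : 'cV[R]_n) = 0.
Proof. by rewrite -(scale0r 0) enormZ normr0 mul0r. Qed.

Lemma enormN u : enorm (- u) = enorm u.
Proof. by rewrite /enorm dotNl dotNr opprK. Qed.

(** Cauchy-Schwarz: for [v != 0], the square of the norm of [(v.v) u - (u.v) v] is [v.v] times the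
    difference of the two sides. *)
Lemma sqr_dot_le u v : dot u v ^+ 2 <= dot u u * dot v v.
Proof.
have [->|v0] := eqVneq v 0.
  by rewrite -(scale0r v) !dotZr !mul0r expr0n mulr0.
have vv : 0 < dot v v by rewrite lt_def dot_eq0 v0 dot_ge0.
have := dot_ge0 (dot v v *: u - dot u v *: v).
rewrite !dot_lin (dotC v u) => h.
rewrite -subr_ge0 -(pmulr_rge0 _ vv); apply: le_trans h _.
by rewrite le_eqVlt; apply/orP; left; apply/eqP; ring.
Qed.

Lemma dot_le_enorm u v : dot u v <= enorm u * enorm v.
Proof.
apply: le_trans (ler_norm _) _.
rewrite -(ler_pXn2r (ltn0Sn 1)) ?nnegrE ?mulr_ge0 ?enorm_ge0//.
by rewrite real_normK ?num_real// exprMn !sqr_enorm sqr_dot_le.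
Qed.

End Dot.

(** * Spectral norm as an operator bound *)

Section SpectralNorm.
Context {R : realType} {m n : nat}.
Implicit Types (A : 'M[R]_(m, n)) (x : 'cV[R]_n).

Lemma dot_mulmx A (x : 'cV[R]_n) (y : 'cV[R]_m) : dot (A *m x) y = dot x (A^T *m y).
Proof. by rewrite /dot trmx_mul mulmxA. Qed.

(** Cauchy-Schwarz on each row gives this Frobenius bound, which makes the supremum in
    [spectral_norm] one of a bounded set. *)
Lemma sqr_enorm_mulmx_le A x :
  enorm (A *m x) ^+ 2 <= (\sum_i enorm (row i A)^T ^+ 2) * enorm x ^+ 2.
Proof.
rewrite sqr_enorm dotE mulr_suml; apply: ler_sum => i _.
rewrite !sqr_enorm -expr2.
have -> : (A *m x) i 0 = dot (row i A)^T x by rewrite /dot trmxK -row_mul [RHS]mxE.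
exact: sqr_dot_le.
Qed.

Lemma has_ubound_spectral A :
  has_ubound [set enorm (A *m x) | x in [set x : 'cV[R]_n | enorm x <= 1]].
Proof.
(* With [S] the sum, [|A x|^2 <= S] on the unit ball; [1 + S] bounds the root of [S] whether or not
   [S] exceeds 1. *)
exists (1 + \sum_i enorm (row i A)^T ^+ 2) => _ [x x1 <-].
set S := \sum_i _; have S0 : 0 <= S by apply: sumr_ge0 => i _; rewrite sqr_ge0.
have := sqr_enorm_mulmx_le A x; rewrite -/S.
have : enorm x ^+ 2 <= 1 by rewrite exprn_ile1 ?enorm_ge0.
have := enorm_ge0 (A *m x); move: (enorm _) (enorm x ^+ 2) S S0 => a b S S0 a0 b1 aSb.
have : S * b <= S by rewrite ler_piMr.
nra.
Qed.

Lemma spectral_norm_ge0 A : 0 <= spectral_norm A.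
Proof.
apply: le_trans (ub_le_sup (has_ubound_spectral A) (imageP _ _)).
  exact: (enorm_ge0 (A *m 0)).
by rewrite /= enorm0 ler01.
Qed.

Lemma enorm_mulmx_le A x : enorm (A *m x) <= spectral_norm A * enorm x.
Proof.
have [x0|x0] := eqVneq (enorm x) 0.
  have /eqP -> : x == 0 by rewrite -dot_eq0 -sqr_enorm x0 expr0n.
  by rewrite mulmx0 !enorm0 mulr0.
have x_gt0 : 0 < enorm x by rewrite lt_def x0 enorm_ge0.
(* Dividing by [|x|] leaves the value at the unit vector [x / |x|], a member of the set under the
   supremum. *)
rewrite -ler_pdivrMr // mulrC.
rewrite -[(enorm x)^-1]gtr0_norm ?invr_gt0// -enormZ scalemxAr.
apply: ub_le_sup (has_ubound_spectral A) _ _; exists ((enorm x)^-1 *: x) => //=.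
by rewrite enormZ gtr0_norm ?invr_gt0// mulVf.
Qed.

Lemma sqr_enorm_mulmx_le_spectral A x :
  enorm (A *m x) ^+ 2 <= spectral_norm A ^+ 2 * enorm x ^+ 2.
Proof.
rewrite -exprMn ler_pXn2r ?nnegrE ?mulr_ge0 ?enorm_ge0 ?spectral_norm_ge0//.
exact: enorm_mulmx_le.
Qed.

End SpectralNorm.

(** * Geometry of the simplex and projection onto it *)

Section Simplex.
Context {R : realType} {n : nat}.
Implicit Types x y z : 'cV[R]_n.

Lemma simplex_segment x y t :
  simplex x -> simplex y -> 0 <= t <= 1 -> simplex (x + t *: (y - x)).
Proof.
move=> [x1 x0] [y1 y0] t01; split=> [|i].
  by rewrite !dot_lin x1 y1 subrr mulr0 addr0.
by rewrite !mxE; have := x0 i; have := y0 i; nra.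
Qed.

Lemma simplex_delta (i : 'I_n) : simplex (delta_mx i 0 : 'cV[R]_n).
Proof.
split=> [|j]; last by rewrite mxE ler0n.
rewrite dotE (bigD1 i) //= !mxE !eqxx mul1r big1 ?addr0//.
by move=> j /negbTE ji; rewrite !mxE ji /= mulr0.
Qed.

Lemma simplex_gt0 x : simplex x -> (0 < n)%N.
Proof.
case=> x1 _; case: (posnP n) => // n0; move: x1; rewrite dotE big1.
  by move/eqP; rewrite eq_sym oner_eq0.
by move=> i; have := ltn_ord i; rewrite [X in (_ < X)%N]n0.
Qed.

Lemma simplex_dot_ge0 x y : simplex x -> simplex y -> 0 <= dot x y.
Proof. by move=> [_ x0] [_ y0]; rewrite dotE sumr_ge0// => i _; rewrite mulr_ge0. Qed.

(** Coordinates lie in [[0, 1]], so each square is at most the coordinate itself. *)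
Lemma simplex_dot_le1 x : simplex x -> dot x x <= 1.
Proof.
move=> [x1 x0]; rewrite -x1 !dotE; apply: ler_sum => i _; rewrite ler_wpM2r//.
rewrite mxE -x1 dotE (bigD1 i) //= !mxE mul1r lerDl.
by apply: sumr_ge0 => j _; rewrite mxE mul1r.
Qed.

(** In [|x - y|^2 = x.x - 2 x.y + y.y] the cross term only decreases the sum and each square is at
    most 1. *)
Lemma simplex_diameter x y : simplex x -> simplex y -> enorm (x - y) <= Num.sqrt 2.
Proof.
move=> xS yS; rewrite /enorm ler_sqrt// !dot_lin (dotC y x).
have := simplex_dot_le1 xS; have := simplex_dot_le1 yS.
have := simplex_dot_ge0 xS yS; lra.
Qed.

(* Moving from [z] towards [y] by the fraction [a / (a + b)], with
   [a = (x - z).(y - z)] and [b = |y - z|^2], would bring [z] closer to [x]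
   if [a > 0]. *)
Lemma eproj_variational (S : set 'cV[R]_n) x y z :
  is_minimizer (fun z => enorm (x - z)) S z ->
  (forall t, 0 <= t <= 1 -> S (z + t *: (y - z))) ->
  dot (x - z) (y - z) <= 0.
Proof.
move=> [_ zmin] Sseg; rewrite leNgt; apply/negP.
set a := dot _ _ => a_gt0; set b := dot (y - z) (y - z).
have b_ge0 : 0 <= b by exact: dot_ge0.
have ab_gt0 : 0 < a + b by lra.
pose t := a / (a + b).
have tab : t * (a + b) = a by rewrite /t divfK// gt_eqF.
have t_gt0 : 0 < t by rewrite divr_gt0.
have t01 : 0 <= t <= 1 by apply/andP; split; nra.
have := zmin _ (Sseg t t01).
rewrite /enorm ler_sqrt ?dot_ge0// opprD addrA.
have -> (c e : 'cV[R]_n) :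
    dot (c - t *: e) (c - t *: e) = dot c c - t * (2 * dot c e - t * dot e e).
  by rewrite !dot_lin (dotC e c); ring.
rewrite -/a -/b lerDl oppr_ge0 leNgt mulr_gt0 //; nra.
Qed.

Lemma eproj_simplex_variational x y : simplex y ->
  dot (x - eproj (@simplex R n) x) (y - eproj (@simplex R n) x) <= 0.
Proof.
move=> yS; have zmin := eproj_simplexP x (simplex_gt0 yS).
apply: eproj_variational (zmin) _ => t t01.
by apply: simplex_segment t01 => //; case: zmin.
Qed.

(** A step size [2^-t] lies in [[0, 1]], so each new iterate is on the segment from the old one to
    its projected trial point. *)
Lemma spg_iterates_simplex (f : 'cV[R]_n -> R) M eta lambda0 (x : nat -> 'cV[R]_n) k :
  spg_iterates f (@simplex R n) M eta lambda0 x k ->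
  forall j, (j <= k)%N -> simplex (x j).
Proof.
move=> [xS _ step]; elim=> [//|j IHj] jk.
have xj := IHj (ltnW jk); have [gamma [t [gE _ _]] ->] := step j jk.
apply: simplex_segment => //.
  by have [] := eproj_simplexP (x j - spg_lambda f lambda0 x j *: gradient f (x j))
    (simplex_gt0 xS).
by rewrite gE exprn_ge0 ?exprn_ile1 ?invr_ge0 ?invf_le1 ?ler1n.
Qed.

End Simplex.

(** The image of the simplex is convex and contains each [v i], the image of a vertex; the hull is
    the smallest such set. *)
Lemma convex_hull_range (R : realType) (m n : nat) (v : 'I_n -> 'cV[R]_m) p :
  convex_hull (range v) p -> exists2 y, simplex y & mx_of_cols v *m y = p.
Proof.
have hull : convex_hull (range v) `<=` [set mx_of_cols v *m y | y in @simplex R n].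
  apply: smallest_sub => [a b l|_ [i _ <-]].
    rewrite !inE => -[y yS <-] [z zS <-].
    exists (z + l%:num *: (y - z)).
      by apply: simplex_segment => //; rewrite ge0 le1.
    rewrite mulmxDr -scalemxAr mulmxBr /conv/=.
    by rewrite scalerBl scale1r scalerBr addrA addrAC [LHS]addrC addrA.
  exists (delta_mx i 0); first exact: simplex_delta.
  by rewrite -colE; apply/colP => j; rewrite !mxE.
by move=> /hull [y yS <-]; exists y.
Qed.

(** * The quadratic objective and the projected gradient gap *)

Section LeastSquares.
Context {R : realType} {m n : nat}.
Variables (A : 'M[R]_(m, n)) (p : 'cV[R]_m).
Local Notation Phi := (half_sqdist A p).
Local Notation L := (spectral_norm A ^+ 2).
Implicit Types x y z s : 'cV[R]_n.

(** The Hessian is [A^T A]. For [z = x - y = s] this reads [s.u = |A s|^2], so [1 / lambda] is a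
    Rayleigh quotient. *)
Lemma dot_gradientB x y z :
  dot z (gradient Phi x - gradient Phi y) = dot (A *m z) (A *m (x - y)).
Proof.
rewrite !gradient_half_sqdist -mulmxBr dot_mulmx; congr (dot _ (_ *m _)).
by rewrite opprB addrA subrK mulmxBr.
Qed.

(** The right side exceeds the left by exactly [|A (x - z)|^2 / 2]. *)
Lemma half_sqdist_sub_le x y z :
  Phi y - Phi z <= dot (gradient Phi x) (y - z) + enorm (A *m (y - x)) ^+ 2 / 2.
Proof.
rewrite gradient_half_sqdist dotC -dot_mulmx dotC !mulmxBr /half_sqdist.
rewrite !sqr_enorm.
move: (A *m x) (A *m y) (A *m z) => a b c.
have := dot_ge0 (a - c); rewrite !dot_lin.
rewrite (dotC p b) (dotC p c) (dotC b a) (dotC c a); lra.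
Qed.

Lemma inv_bb_le s : dot (A *m s) (A *m s) / dot s s <= L.
Proof.
(* For [s = 0] the quotient [0 / 0] is 0 by convention. *)
have [s0|s0] := eqVneq s 0.
  by rewrite s0 mulmx0 -!sqr_enorm !enorm0 expr0n mul0r sqr_ge0.
rewrite ler_pdivrMr; last by rewrite lt_def dot_eq0 s0 dot_ge0.
by rewrite -!sqr_enorm sqr_enorm_mulmx_le_spectral.
Qed.

(** The factor [3 / 2] is [1 + 1 / 2], from the linear and the quadratic term of the expansion at
    [x]. *)
Lemma projected_gradient_gap x z lambda :
  let y := eproj (@simplex R n) (x - lambda *: gradient Phi x) in
  simplex x -> simplex z -> 0 < lambda -> 1 / lambda <= L ->
  Phi y - Phi z <= 3 / 2 * L * Num.sqrt 2 * enorm (y - x).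
Proof.
move=> y xS zS lam_gt0 lamL.
have yS : simplex y.
  by have [] := eproj_simplexP (x - lambda *: gradient Phi x) (simplex_gt0 xS).
have yx := simplex_diameter yS xS; have yz := simplex_diameter yS zS.
have := eproj_simplex_variational (x - lambda *: gradient Phi x) zS; rewrite -/y => var.
(* Expanding [var] gives [lambda g.(y - z) <= (x - y).(y - z)] for the gradient [g] at [x];
   Cauchy-Schwarz does the rest. *)
have gw : dot (gradient Phi x) (y - z) <= 1 / lambda * (enorm (y - x) * enorm (y - z)).
  have cs := dot_le_enorm (x - y) (y - z); rewrite -enormN opprB in cs.
  rewrite mul1r mulrC ler_pdivlMr// mulrC; apply: le_trans cs.
  by move: var; rewrite !dot_lin; lra.
have Ad := sqr_enorm_mulmx_le_spectral A (y - x).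
have gap := half_sqdist_sub_le x y z.
have d0 := enorm_ge0 (y - x); have w0 := enorm_ge0 (y - z).
have L0 : 0 <= L by rewrite sqr_ge0.
have h1 : 1 / lambda * (enorm (y - x) * enorm (y - z)) <= L * (enorm (y - x) * Num.sqrt 2).
  apply: ler_pM => //; [by rewrite divr_ge0 // ltW | exact: mulr_ge0 | exact: ler_wpM2l].
have h2 : L * enorm (y - x) ^+ 2 <= L * (enorm (y - x) * Num.sqrt 2).
  by apply: ler_wpM2l => //; rewrite expr2; apply: ler_wpM2l.
lra.
Qed.

End LeastSquares.

(** * Gap at an SPG iterate and its stopping criterion *)

Theorem mainTheorem3 (R : realType) (m n : nat)
    (v : 'I_n -> 'cV[R]_m) (p : 'cV[R]_m) (eps : R)
    (M : nat) (eta lambda0 : R)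
    (x : nat -> 'cV[R]_n) (k : nat) (xstar : 'cV[R]_n) :
  let A := mx_of_cols v in
  let rad := max_dist v p in
  let Phi := half_sqdist A p in
  let Delta := @simplex R n in
  let L := spectral_norm A ^+ 2 in
  let D := Num.sqrt 2 : R in
  let s := x k - x k.-1 in
  let u := gradient Phi (x k) - gradient Phi (x k.-1) in
  let lambda := dot s s / dot s u in
  let xbar := eproj Delta (x k - lambda *: gradient Phi (x k)) in
  let d := xbar - x k in
  0 < eps < 1 ->
  (1 <= M)%N -> 0 < eta < 1 -> 0 < lambda0 ->
  is_minimizer Phi Delta xstar ->
  (1 <= k)%N -> spg_iterates Phi Delta M eta lambda0 x k ->
  dot s u != 0 ->
  [/\ 1 / lambda <= L,
      Phi xbar - Phi xstar <= 3 / 2 * L * D * enorm (xbar - x k)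
    & enorm d <= enorm (A *m xbar - p) / (3 * L * D) * (eps * rad) ->
      [/\ enorm (A *m xbar - p) <= enorm (A *m xstar - p) + eps * rad,
          convex_hull (range v) p -> enorm (A *m xbar - p) <= eps * rad
        & eps * rad < enorm (A *m xbar - p) ->
            0 < enorm (A *m xstar - p) /\ ~ convex_hull (range v) p]].
Proof.
move=> A rad Phi Delta L D s u lambda xbar d /andP[eps0 _] _ _ _ [xstarS xstar_min].
move=> _ iter su_neq0.
have xkS : simplex (x k) by exact: spg_iterates_simplex iter k (leqnn k).
have suE : dot s u = dot (A *m s) (A *m s) by exact: dot_gradientB.
have su_gt0 : 0 < dot s u by rewrite lt_def su_neq0 suE dot_ge0.
have s_neq0 : s != 0.
  by apply: contraNneq su_neq0 => s0; rewrite suE s0 mulmx0 dot_eq0.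
have ss_gt0 : 0 < dot s s by rewrite lt_def dot_eq0 s_neq0 dot_ge0.
have lamL : 1 / lambda <= L by rewrite div1r invf_div suE inv_bb_le.
have lam_gt0 : 0 < lambda by rewrite divr_gt0.
have gap : Phi xbar - Phi xstar <= 3 / 2 * L * D * enorm (xbar - x k).
  exact: projected_gradient_gap.
split=> // d_le.
(* Positivity of [L] makes the division by [3 L D] in the criterion a genuine one. *)
have L_gt0 : 0 < L by apply: lt_le_trans lamL; rewrite divr_gt0.
have D_gt0 : 0 < D by rewrite sqrtr_gt0.
have rad_ge0 : 0 <= eps * rad.
  apply: mulr_ge0; first exact: ltW.
  by rewrite /rad /max_dist; elim/big_ind: _ => // [a b a0 b0|i _];
    [rewrite le_max a0 | exact: enorm_ge0].
have rle : enorm (A *m xbar - p) <= enorm (A *m xstar - p) + eps * rad.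
  have LD_gt0 : 0 < 3 * L * D by rewrite (mulr_gt0 (mulr_gt0 _ L_gt0) D_gt0).
  rewrite mulrAC ler_pdivlMr// in d_le.
  move: gap d_le; rewrite /Phi /half_sqdist -/d.
  have := enorm_ge0 (A *m xbar - p); have := enorm_ge0 (A *m xstar - p).
  move: (enorm (_ - p)) (enorm (_ - p)) (enorm d) (eps * rad) rad_ge0.
  move=> rs r dd e e0 rs0 r0 gap d_le.
  (* If [r > rs + e], then [(r - rs) (r + rs) > e (r + rs) >= r e], against the bound from the gap
     and the criterion. *)
  rewrite leNgt; apply/negP => lt_r.
  have : (r - rs) * (r + rs) <= r * e by nra.
  nra.
have hull0 : convex_hull (range v) p -> enorm (A *m xstar - p) = 0.
  move=> /convex_hull_range[y yS Ay]; have := xstar_min y yS.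
  rewrite /Phi /half_sqdist Ay subrr enorm0.
  rewrite expr0n mul0r ler_pdivrMr// mul0r => r_le0.
  by apply/eqP; rewrite -sqrf_eq0 eq_le r_le0 sqr_ge0.
split=> // [/hull0 r0|lt_r]; first by rewrite r0 add0r in rle.
split; first lra.
by move=> /hull0 r0; move: rle lt_r; rewrite r0 add0r leNgt => /negP.
Qed.
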